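(* Let $\boldsymbol S=(S_1,\dots,S_d)$ be a multivariate Lévy process on $(\Omega,\mathcal F,\mathbb P)$ with $\boldsymbol S(0)=0$, $S=\sum_{j=1}^dS_j$, let $0<T<\infty$, $\alpha\in[0,1]$ and $i\in\{1,\dots,d\}$. Suppose there are (small) $\delta,\bar\delta>0$ such that, for all $x_i\in[1-\delta,1+\delta]$, the individual processes $S_1,\dots,S_d$ and the aggregated process $\sum_{j\ne i}S_j+x_iS_i$ are either continuous (i.e. scaled Brownian motions with drift) or compound Poisson processes with negative drift and positive jumps. Write $Z_{i,T}(x_i)=\sup_{t\in[0,T]}\big(\sum_{j\neq i}S_j(t)+x_iS_i(t)\big)$, let $q_i(x_i)$ be its dynamic value-at-risk quantile (see context), and assume that $Z_{i,T}(x_i)$ has a density $y_i\mapsto f_{i,x_i}(y_i)$ at the points $y_i\in[q_i(x_i)-\bar\delta,q_i(x_i)+\bar\delta]$. Assume further: (i) $f_{i,x_i}(y_i)<\infty$ is continuous in $y_i,x_i$ for all $x_i\in[1-\delta,1+\delta]$ and $y_i\in[q_i(x_i)-\bar\delta,q_i(x_i)+\bar\delta]$; (ii) $f_{i,x_i}(q_i(x_i))>0$ for each $x_i\in[1-\delta,1+\delta]$; (iii) $\mathbb E[S_i(t^*_{i,T}(x_i))\mid Z_{i,T}(x_i)=y_i]$ and $\mathbb E[|S_i(t^*_{i,T}(x_i))|\mid Z_{i,T}(x_i)=y_i]$ exist and are continuous in $y_i,x_i$ for all $x_i\in[1-\delta,1+\delta]$ and $y_i\in[q_i(x_i)-\bar\delta,q_i(x_i)+\bar\delta]$;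 (iv) $\mathbb E\big[\sup_{t\in[0,T]}|S_i(t)|\big]<\infty$. Then the gradient allocation $\mathrm{GVaR}^\alpha_i(S,T)=\frac{\partial q_i(x_i)}{\partial x_i}\Big|_{x_i=1}$ exists and $$\mathrm{GVaR}^\alpha_i(S,T)=\mathbb E\left[S_i(t^*_T)\,\Big|\,\sup_{t\in[0,T]}S(t)=\mathrm{VaR}^\alpha(S,T)\right].$$
   Context: For a real-valued process $R$, the dynamic value-at-risk is $\mathrm{VaR}^\alpha(R,T)=\inf\{u\ge0:\mathbb P(\sup_{t\in[0,T]}R(t)\ge u)\le\alpha\}$. The quantile function is $q_i(x_i)=\mathrm{VaR}^\alpha\big(\sum_{j\ne i}S_j+x_iS_i,\,T\big)$, so $q_i(1)=\mathrm{VaR}^\alpha(S,T)$. $t^*_{i,T}(x_i)$ is the first time at which the supremum is attained: the minimum of the set $\{t\in[0,T]:\sum_{j\ne i}S_j(t)+x_iS_i(t)=\sup_{s\in[0,T]}(\sum_{j\neq i}S_j(s)+x_iS_i(s))\}$, and $+\infty$ if this set is empty. $t^*_T=t^*_{i,T}(1)$ is the corresponding time for $S$. ''Compound Poisson process with negative drift and positive jumps'' means a process of the form $-ct+\sum_{k=1}^{N(t)}J_k$ with $c>0$, i.e. the linear drift coefficient is negative, where $N$ is a Poisson process and the i.i.d. jumps $J_k$ (independent of $N$) are positive. Conditional expectations given $Z_{i,T}(x_i)=y_i$ are understood as the versions that are continuous as in (iii). *)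

(* Defs.v *)
(* A real-valued process is a function [X : R -> Omega -> R] of time and
   outcome; only its values at times [t >= 0] are ever constrained or used. *)
From HB Require Import structures.
From mathcomp Require Import all_boot all_order all_algebra finmap.
From mathcomp Require Import all_classical all_reals all_analysis.

Set Implicit Arguments.
Unset Strict Implicit.
Unset Printing Implicit Defensive.

Import Order.TTheory GRing.Theory Num.Theory.
Import numFieldNormedType.Exports.

Local Open Scope classical_set_scope.
Local Open Scope ring_scope.

Section independence.
Context {disp : measure_display} {R : realType} {Omega : measurableType disp}.
Variable P : probability Omega R.

Definition mutually_independent {disp' : measure_display} {I : choiceType}
    {T : measurableType disp'} (X : I -> Omega -> T) : Prop :=
  forall (J : {fset I}) (B : I -> set T), (forall k, measurable (B k)) ->
    P (\bigcap_(k in [set` J]) (X k @^-1` B k)) =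
    (\prod_(k <- J) P (X k @^-1` B k))%E.

Definition sigma_generated {disp' : measure_display} {I : Type}
    {T : measurableType disp'} (D : set I) (X : I -> Omega -> T) :
    set_system Omega :=
  <<s \bigcup_(k in D) preimage_set_system setT (X k) measurable >>.

Definition independent_systems (F G : set_system Omega) : Prop :=
  forall A B, F A -> G B -> P (A `&` B) = (P A * P B)%E.

End independence.

Section processes.
Context {disp : measure_display} {R : realType} {Omega : measurableType disp}.
Variable P : probability Omega R.

Definition cadlag (x : R -> R) : Prop :=
  (forall t, 0 <= t -> x s @[s --> t^'+] --> x t) /\
  (forall t, 0 < t -> cvg (x s @[s --> t^'-])).

Definition increment {n : nat} (S : 'I_n -> R -> Omega -> R) (s t : R)
    (w : Omega) : n.-tuple R :=
  [tuple S j t w - S j s w | j < n].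

(* [levy_indep] quantifies over infinite grids; a finite grid is one that is
   eventually constant, the superfluous increments being 0. *)
Record levy_process {n : nat} (S : 'I_n -> R -> Omega -> R) : Prop := {
  levy_measurable : forall j t, 0 <= t -> measurable_fun setT (S j t) ;
  levy_start : forall j w, S j 0 w = 0 ;
  levy_indep : forall t : nat -> R, 0 <= t 0%N ->
    {homo t : k l / (k <= l)%N >-> k <= l} ->
    mutually_independent P (fun k : nat => increment S (t k) (t k.+1)) ;
  levy_stationary : forall s h (A : set (n.-tuple R)), 0 <= s -> 0 <= h ->
    measurable A ->
    P (increment S s (s + h) @^-1` A) = P (increment S 0 h @^-1` A) ;
  levy_stochastic_continuity : forall j t e, 0 <= t -> 0 < e ->
    P [set w | e <= `|S j s w - S j t w|]
      @[s --> within `[0, +oo[ (nbhs t)] --> 0%E ;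
  levy_cadlag : forall j w, cadlag (S j ^~ w) }.

(* For a Lévy process (each component and each linear combination of the
   components of a multivariate Lévy process is one) this says exactly that it is a (possibly degenerate)
   scaled Brownian motion with drift. *)
Definition continuous_process (X : R -> Omega -> R) : Prop :=
  {ae P, forall w, {within `[0, +oo[, continuous (X ^~ w)}}.

Record poisson_process (lambda : R) (N : R -> Omega -> nat) : Prop := {
  poisson_measurable : forall t, 0 <= t -> measurable_fun setT (N t) ;
  poisson_start : forall w, N 0 w = 0%N ;
  poisson_monotone : forall w s t, 0 <= s -> s <= t -> (N s w <= N t w)%N ;
  poisson_right_continuous : forall w t, 0 <= t ->
    \forall s \near t^'+, N s w = N t w ;
  poisson_indep : forall t : nat -> R, 0 <= t 0%N ->
    {homo t : k l / (k <= l)%N >-> k <= l} ->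
    mutually_independent P
      (fun (k : nat) (w : Omega) => (N (t k.+1) w - N (t k) w)%N) ;
  poisson_law : forall s t k, 0 <= s -> s < t ->
    P [set w | (N t w - N s w)%N = k] =
    (poisson_pmf (lambda * (t - s)) k)%:E }.

Definition iid_sequence (J : nat -> Omega -> R) : Prop :=
  [/\ forall k, measurable_fun setT (J k),
      mutually_independent P J &
      forall k (A : set R), measurable A -> P (J k @^-1` A) = P (J 0%N @^-1` A)].

Definition compound_poisson_neg_drift_pos_jumps (X : R -> Omega -> R) : Prop :=
  exists (c lambda : R) (N : R -> Omega -> nat) (J : nat -> Omega -> R),
    [/\ 0 < c, 0 < lambda & poisson_process lambda N] /\
    [/\ iid_sequence J,
        {ae P, forall w, forall k, 0 < J k w},
        independent_systems P (sigma_generated `[0, +oo[ N)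
                              (sigma_generated setT J) &
        {ae P, forall w, forall t, 0 <= t ->
           X t w = - c * t + \sum_(k < N t w) J k w}].

Definition admissible_process (X : R -> Omega -> R) : Prop :=
  continuous_process X \/ compound_poisson_neg_drift_pos_jumps X.

(* [sup] is the real supremum; it is meaningful here since càdlàg paths are
   bounded on [0, T]. *)
Definition running_sup (X : R -> Omega -> R) (T : R) (w : Omega) : R :=
  sup [set X t w | t in `[0, T]].

Definition argmax_times (X : R -> Omega -> R) (T : R) (w : Omega) : set R :=
  [set t | t \in `[0, T] /\ X t w = running_sup X T w].

(* For right-continuous paths the infimum of a nonempty [argmax_times] belongs
   to it, so it is its minimum; the infimum of the empty set is +oo. *)
Definition first_argmax (X : R -> Omega -> R) (T : R) (w : Omega) : \bar R :=
  ereal_inf [set t%:E | t in argmax_times X T w].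

(* [inf set0 = 0]; the set below is empty only if [alpha = 0] and the running
   supremum is not essentially bounded. *)
Definition dynVaR (alpha : R) (X : R -> Omega -> R) (T : R) : R :=
  inf [set u | 0 <= u /\
    (P [set w | (u <= running_sup X T w)%R] <= alpha%:E)%E].

Definition aggregate {n : nat} (S : 'I_n -> R -> Omega -> R) (t : R) (w : Omega) :
    R :=
  \sum_(j < n) S j t w.

Definition perturbed {n : nat} (S : 'I_n -> R -> Omega -> R) (i : 'I_n) (x : R)
    (t : R) (w : Omega) : R :=
  \sum_(j < n | j != i) S j t w + x * S i t w.

Lemma perturbed1 {n : nat} (S : 'I_n -> R -> Omega -> R) (i : 'I_n) :
  perturbed S i 1 = aggregate S.
Proof.
apply/funext => t; apply/funext => w.
by rewrite /aggregate (bigD1 i) //= /perturbed mul1r addrC.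
Qed.

Definition quantile {n : nat} (S : 'I_n -> R -> Omega -> R) (alpha T : R)
    (i : 'I_n) (x : R) : R :=
  dynVaR alpha (perturbed S i x) T.

Definition GVaR {n : nat} (S : 'I_n -> R -> Omega -> R) (alpha T : R)
    (i : 'I_n) : R :=
  ((quantile S alpha T i)^`())%classic 1.

(* S_i(t^*_{i,T}(x)); [fine] sends the time +oo to 0. *)
Definition at_first_argmax {n : nat} (S : 'I_n -> R -> Omega -> R) (T : R)
    (i : 'I_n) (x : R) (w : Omega) : R :=
  S i (fine (first_argmax (perturbed S i x) T w)) w.

Definition has_density_on (Z : Omega -> R) (D : set R) (f : R -> R) : Prop :=
  [/\ measurable_fun D f,
      forall y, D y -> 0 <= f y &
      forall A : set R, measurable A -> A `<=` D ->
        P (Z @^-1` A) = (\int[lebesgue_measure]_(y in A) (f y)%:E)%E].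

(* [m] is a version of y |-> E[X | Z = y]. *)
Definition is_cond_expectation (X Z : Omega -> R) (m : R -> R) : Prop :=
  [/\ P.-integrable setT (fun w => (X w)%:E),
      measurable_fun setT m,
      P.-integrable setT (fun w => (m (Z w))%:E) &
      forall B : set R, measurable B ->
        (\int[P]_(w in Z @^-1` B) (X w)%:E =
         \int[P]_(w in Z @^-1` B) (m (Z w))%:E)%E].

End processes.

Section window.
Context {R : realType}.

Definition window (q : R -> R) (delta dbar : R) : set (R * R) :=
  [set p | p.1 \in `[1 - delta, 1 + delta] /\
           p.2 \in `[q p.1 - dbar, q p.1 + dbar]].

Definition jointly_continuous_on (D : set (R * R)) (g : R -> R -> R) : Prop :=
  {within D, continuous (fun p : R * R => g p.1 p.2)}.

End window.

(* Main.v *)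
(* For fixed outcome, Z_x = sup_t (sum_(j != i) S_j + x S_i)(t) is a supremum of
   affine functions of x, hence convex, and G_x = S_i(t*_x) is a subgradient
   whenever the supremum is attained; it almost surely is, because the paths are
   right-continuous and never jump downwards. Consequently the expectation of
   (Z_x - y)^+ is, formally, convex in (x, y) with gradient
   (E[G_x; Z_x >= y], - P(Z_x >= y)). Equality of the mixed derivatives gives
     d/dx P(Z_x >= y) = - d/dy E[G_x; Z_x >= y] = f_x(y) E[G_x | Z_x = y],
   and differentiating P(Z_x >= q(x)) = alpha implicitly gives
   q'(x) = E[G_x | Z_x = q(x)]. As Z_x need not be integrable, (Z_x - y)^+ is
   replaced by the bounded difference (Z_x - y)^+ - (Z_x - y - k)^+, and the
   mixed derivative by difference quotients over small rectangles. *)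
Require Import Defs.
From mathcomp Require Import all_boot all_order all_algebra.
From mathcomp Require Import all_classical all_reals all_analysis.
From mathcomp Require Import measurable_realfun ring lra.
Import Order.TTheory GRing.Theory Num.Theory.
Import numFieldNormedType.Exports.
Local Open Scope classical_set_scope.
Local Open Scope ring_scope.

(* [D] is arbitrary: over N equal steps its contribution telescopes to
   (b - a) / N * (D b - D a), which vanishes as N grows. *)
Lemma telescoped_increment_ge {R : realType} (Psi D : R -> R) (a b c : R) :
  a <= b ->
  (forall u v, a <= u -> u <= v -> v <= b ->
     (v - u) * (c - (D v - D u)) <= Psi v - Psi u) ->
  (b - a) * c <= Psi b - Psi a.
Proof.
move=> ab H.
set d := (b - a) * (D b - D a).
set g := (b - a) * c - (Psi b - Psi a).
(* [g] is the amount by which the claim would fail; if it were positive, an [N] beyond [|d| / g]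
   would violate this bound. *)
suff HN N : g * N.+1%:R <= d.
  rewrite -subr_le0 -/g leNgt; apply/negP => g0.
  have d1 : 0 <= `|d| / g by rewrite divr_ge0 // ltW.
  have := archi_boundP d1.
  set N := Num.bound _.
  rewrite ltr_pdivrMr // => dN.
  have := HN N; rewrite -natr1 mulrDr mulr1 => dN'.
  have := ler_norm d; move: dN; rewrite mulrC; lra.
pose s := (b - a) / N.+1%:R.
have N0 : 0 < N.+1%:R :> R by rewrite ltr0n.
have sN : N.+1%:R * s = b - a by rewrite /s mulrC mulfVK // gt_eqF.
have s0 : 0 <= s by rewrite divr_ge0 // ?subr_ge0 // ltW.
pose u k : R := a + k%:R * s.
have u0 : u 0%N = a by rewrite /u mul0r addr0.
have uN : u N.+1 = b by rewrite /u sN addrC subrK.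
have uS k : u k.+1 - u k = s by rewrite /u -natr1; ring.
have tele (F : R -> R) : F b - F a = \sum_(0 <= k < N.+1) (F (u k.+1) - F (u k)).
  by rewrite (telescope_sumr (fun k => F (u k))) // u0 uN.
have step k : (k < N.+1)%N ->
    s * (c - (D (u k.+1) - D (u k))) <= Psi (u k.+1) - Psi (u k).
  move=> kN; rewrite -{1}(uS k); apply: H.
  - by rewrite /u lerDl mulr_ge0.
  - by rewrite -subr_ge0 uS.
  - by rewrite -uN /u lerD2l ler_wpM2r // ler_nat.
have : \sum_(0 <= k < N.+1) (s * (c - (D (u k.+1) - D (u k)))) <= Psi b - Psi a.
  rewrite tele big_nat [leRHS]big_nat; apply: ler_sum => k /andP[_ kN].
  exact: step.
rewrite -mulr_sumr big_split /= sumrN -tele sumr_const_nat subn0.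
rewrite -(ler_pM2r N0) mulrAC [s * _]mulrC sN -mulr_natr /g /d => h.
lra.
Qed.

Lemma restrictE {T : Type} {R : realType} (A : set T) (X : T -> R) w :
  (X \_ A) w = if w \in A then X w else 0.
Proof. by rewrite patchE. Qed.

(** * Convex families of random variables and their quantiles *)

Section expectations.
Context {disp : measure_display} {R : realType} {Omega : measurableType disp}.
Variable P : probability Omega R.

(** [Y - X] agrees almost everywhere with its absolute value, so its integral is nonnegative. The
    subgradient inequalities hold only almost surely, hence this form. *)
Lemma ae_le_Rintegral (X Y : Omega -> R) :
  P.-integrable setT (EFin \o X) -> P.-integrable setT (EFin \o Y) ->
  {ae P, forall w, X w <= Y w} -> \int[P]_w X w <= \int[P]_w Y w.
Proof.
move=> iX iY XY.
have iD : P.-integrable setT (EFin \o (Y \- X)).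
  have := integrableB measurableT iY iX.
  by apply: eq_integrable => // w _ /=; rewrite EFinB.
rewrite -subr_ge0 -RintegralB //.
have -> : \int[P]_w (Y w - X w) = \int[P]_w `|Y w - X w|.
  congr fine; apply: ae_eq_integral => //; [exact: measurable_int iD| |].
    exact: measurable_int (integrable_norm iD).
  by apply: filterS XY => w XY _ /=; rewrite ger0_norm // subr_ge0.
exact: Rintegral_ge0.
Qed.

Lemma integrable_restrict (A : set Omega) (X : Omega -> R) :
  measurable A -> P.-integrable setT (EFin \o X) ->
  P.-integrable setT (EFin \o (X \_ A)).
Proof.
move=> mA iX.
rewrite -restrict_EFin -integrable_mkcond //.
exact: integrableS iX.
Qed.

Lemma integrable_cst_restrict (A : set Omega) (k : R) :
  measurable A -> P.-integrable setT (EFin \o (cst k \_ A)).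
Proof.
by move=> mA; apply: integrable_restrict => //; exact: finite_measure_integrable_cst.
Qed.

Lemma Rintegral_cst_restrict (A : set Omega) (k : R) :
  measurable A -> \int[P]_w (cst k \_ A) w = k * fine (P A).
Proof. by move=> mA; rewrite -Rintegral_mkcond Rintegral_cst. Qed.
End expectations.

Section call_spread.
Context {R : realType}.
Implicit Types y k z g : R.

(* A bounded Lipschitz substitute for the indicator of [z >= y]: it lies between
   k 1_(z >= y + k) and k 1_(z >= y). *)
Definition call_spread y k z := Num.max (z - y) 0 - Num.max (z - (y + k)) 0.

Lemma call_spread_bound y k z : 0 <= k -> 0 <= call_spread y k z <= k.
Proof.
by move=> k0; rewrite /call_spread; case: (leP (z - y)); case: (leP (z - (y + k))); lra.
Qed.

(** Convexity of [(z - y)^+]: the indicator of [z >= y] is a subgradient, taken at the old point for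
    the lower bound and at the new point for the upper one. The increments [a] and [b] may have
    either sign. *)
Lemma positive_part_increment y z z' a b : z + a <= z' -> z' <= z + b ->
  (if y <= z then a else 0) <=
    Num.max (z' - y) 0 - Num.max (z - y) 0 <= (if y <= z' then b else 0).
Proof.
move=> za zb; case: (leP (z' - y) 0); case: (leP (z - y) 0);
  case: (leP y z); case: (leP y z'); lra.
Qed.

Lemma measurable_call_spread y k : measurable_fun setT (call_spread y k).
Proof.
rewrite /call_spread.
by apply: measurable_funB; apply: measurable_maxr => //; apply: measurable_funB.
Qed.

End call_spread.

Lemma Rintegral_bound {d : measure_display} {T : measurableType d}
    {R : realType} (mu : {measure set T -> \bar R}) (D : set T) (X : T -> R)
    (c e : R) :
  measurable D -> (mu D < +oo)%E -> measurable_fun D X ->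
  (forall w, D w -> `|X w - c| <= e) ->
  `|\int[mu]_(w in D) X w - c * fine (mu D)| <= e * fine (mu D).
Proof.
move=> mD fD mX Xc.
have b w : D w -> c - e <= X w <= c + e by move=> /Xc; rewrite ler_distl.
have iX : mu.-integrable D (EFin \o X).
  apply: measurable_bounded_integrable => //.
  exists (`|c| + e); split; [exact: num_real|] => M kM w Dw /=.
  rewrite (le_trans _ (ltW kM)) // -[X w](subrK c) (le_trans (ler_normD _ _)) //.
  by rewrite addrC lerD2l Xc.
have ic r : mu.-integrable D (EFin \o cst r).
  apply: measurable_bounded_integrable => //.
  by exists `|r|; split; [exact: num_real|] => M /ltW rM w _.
rewrite ler_distl -mulrBl -mulrDl -!(Rintegral_cst mu mD); apply/andP; split.
  by apply: le_Rintegral => // [|w /b /andP[]//]; exact: ic.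
by apply: le_Rintegral => // [|w /b /andP[]//]; exact: ic.
Qed.

(** As [F x (q x)] is constant near [x0], the two expansions give [f0 dq - c h = o(|h| + |dq|)] for
    the increment [dq] of [q]. Since [f0 > 0], this first forces [dq = O(h)] and then
    [dq / h -> c / f0]. The expansion in [x] is uniform in [y] because it is used at the moving
    level [y = q x]. *)
Lemma implicit_derivative {R : realType} (F : R -> R -> R) (q : R -> R)
    (x0 c f0 : R) : 0 < f0 ->
  q x @[x --> x0] --> q x0 ->
  (forall e, 0 < e -> \forall x \near x0 & y \near q x0,
     `|F x y - F x0 y - c * (x - x0)| <= e * `|x - x0|) ->
  (forall e, 0 < e -> \forall y \near q x0,
     `|F x0 y - F x0 (q x0) + f0 * (y - q x0)| <= e * `|y - q x0|) ->
  (\forall x \near x0, F x (q x) = F x0 (q x0)) ->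
  is_derive x0 1 q (c / f0).
Proof.
move=> f00 qc Fx Fy Fq.
suff quotient : h^-1 *: (q (h *: 1 + x0) - q x0) @[h --> 0^'] --> c / f0.
  by apply: DeriveDef; [exact: cvgP quotient|exact: cvg_lim quotient].
have shift : (fun h : R => h *: 1 + x0) @ 0^' --> x0.
  rewrite -[X in _ --> X]add0r; apply: cvgD; last exact: cvg_cst.
  rewrite -[X in _ --> X](scale0r (1 : R^o)).
  by apply: cvgZl; exact: cvg_within.
apply/cvgrPdist_le => e e0.
(* [A] will bound [|dq| / |h|]: [eta <= f0 / 2] lets the [|dq|] term be absorbed, and
   [eta (1 + A) <= e f0] controls the final quotient. *)
pose A := 2 * (`|c| + f0) / f0.
have A0 : 0 <= A by rewrite divr_ge0 ?mulr_ge0 ?addr_ge0 // ltW.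
have A1 : 0 < 1 + A by rewrite ltr_wpDr.
pose eta := Num.min (f0 / 2) (e * f0 / (1 + A)).
have eta0 : 0 < eta by rewrite lt_min !divr_gt0 ?mulr_gt0.
have eta1 : eta <= f0 / 2 by rewrite ge_min lexx.
have eta2 : eta * (1 + A) <= e * f0.
  by rewrite -ler_pdivlMr // ge_min lexx orbT.
have Fxq : \forall x \near x0,
    `|F x (q x) - F x0 (q x) - c * (x - x0)| <= eta * `|x - x0|.
  have [[U V] [/= Ux Vq UV]] := Fx eta eta0.
  apply: filterS2 Ux (qc _ Vq) => x xU xV.
  exact: (UV (x, q x)).
have Fyq : \forall x \near x0,
    `|F x0 (q x) - F x0 (q x0) + f0 * (q x - q x0)| <= eta * `|q x - q x0|.
  exact: qc _ (Fy eta eta0).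
near=> h.
have h0 : h != 0 by near: h; exact: nbhs_dnbhs_neq.
have h1 : F (h *: 1 + x0) (q (h *: 1 + x0)) = F x0 (q x0).
  by near: h; exact: shift _ Fq.
have h2 : `|F x0 (q (h *: 1 + x0)) - F x0 (q x0) + f0 * (q (h *: 1 + x0) - q x0)|
    <= eta * `|q (h *: 1 + x0) - q x0|.
  by near: h; exact: shift _ Fyq.
have h3 : `|F (h *: 1 + x0) (q (h *: 1 + x0)) - F x0 (q (h *: 1 + x0))
    - c * (h *: 1 + x0 - x0)| <= eta * `|h *: 1 + x0 - x0|.
  by near: h; exact: shift _ Fxq.
move: h3 h2; rewrite h1 addrK [h *: 1]mulr1 => h3 h2.
set dq := q (h + x0) - q x0 in h2 *.
have main : `|f0 * dq - c * h| <= eta * (`|h| + `|dq|).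
  rewrite [leRHS]mulrDr (le_trans _ (lerD h3 h2)) // (le_trans _ (ler_normD _ _)) //.
  by rewrite le_eqVlt; apply/orP; left; apply/eqP; congr `|_|; ring.
have dqA : `|dq| <= A * `|h|.
  rewrite /A mulrAC ler_pdivlMr //.
  have : `|f0 * dq| <= `|f0 * dq - c * h| + `|c * h|.
    by rewrite -{1}[f0 * dq](subrK (c * h)) ler_normD.
  rewrite !normrM (gtr0_norm f00).
  have : eta * (`|h| + `|dq|) <= f0 / 2 * (`|h| + `|dq|).
    by rewrite ler_wpM2r // addr_ge0.
  have : 0 <= f0 * `|h| by rewrite mulr_ge0 ?normr_ge0 ?(ltW f00).
  move: main; lra.
have h00 : 0 < `|h| by rewrite normr_gt0.
have -> : c / f0 - h^-1 *: dq = - ((f0 * dq - c * h) / (f0 * h)).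
  by rewrite /GRing.scale /=; field; rewrite h0 gt_eqF.
rewrite normrN normrM normfV normrM (gtr0_norm f00) ler_pdivrMr ?mulr_gt0 //.
apply: le_trans main _; rewrite mulrA.
apply: (@le_trans _ _ (eta * (1 + A) * `|h|)); last by rewrite ler_wpM2r.
by rewrite -mulrA ler_wpM2l ?(ltW eta0) // mulrDl mul1r lerD2l.
Unshelve. all: by end_near.
Qed.

Lemma near_pair_box {R : realType} (x0 y0 : R) (Q : R -> R -> Prop) :
  (\forall p \near (x0, y0), Q p.1 p.2) ->
  exists2 r : R, 0 < r & forall x y, `|x - x0| < r -> `|y - y0| < r -> Q x y.
Proof.
move=> /nbhs_ballP[r /= r0 h]; exists r => // x y xr yr.
by apply: (h (x, y)); split; rewrite /ball /= distrC.
Qed.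

(** * Tails and tail gradients of a convex family *)

Section convex_family.
Context {disp : measure_display} {R : realType} {Omega : measurableType disp}.
Variable P : probability Omega R.
Variables (lo hi : R) (Z G : R -> Omega -> R).
Hypothesis mZ : forall x, lo <= x <= hi -> measurable_fun setT (Z x).
Hypothesis iG : forall x, lo <= x <= hi -> P.-integrable setT (EFin \o G x).
Hypothesis subgradient : forall x x', lo <= x <= hi -> lo <= x' <= hi ->
  {ae P, forall w, Z x w + (x' - x) * G x w <= Z x' w}.

Definition upper x y := [set w | y <= Z x w].
Definition tail x y := fine (P (upper x y)).
(** Formally the derivative in [x] of [E[(Z_x - y)^+]]. The level comes first so that
    [tail_grad (y + k)] is a function of the parameter, ready to serve as the telescoping [D]. *)
Definition tail_grad y x := \int[P]_(w in upper x y) G x w.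
Definition mean_spread y k x := \int[P]_w call_spread y k (Z x w).

Lemma upper_preimage x y : upper x y = Z x @^-1` `[y, +oo[.
Proof. by apply/seteqP; split => w; rewrite /upper /= in_itv /= andbT. Qed.

Lemma measurable_upper x y : lo <= x <= hi -> measurable (upper x y).
Proof.
by move=> /mZ mx; rewrite upper_preimage -[X in measurable X]setTI; exact: mx.
Qed.

Lemma integrable_spread (y k x : R) : 0 <= k -> lo <= x <= hi ->
  P.-integrable setT (EFin \o (fun w => call_spread y k (Z x w))).
Proof.
move=> k0 xI; apply: measurable_bounded_integrable => //.
- by apply: le_lt_trans (probability_le1 P measurableT) _; rewrite ltry.
- apply: measurableT_comp; [exact: measurable_call_spread|exact: mZ].
- exists k; split; [exact: num_real|] => M kM w _ /=.
  have /andP[a b] := call_spread_bound y k (Z x w) k0.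
  by rewrite ger0_norm // ltW // (le_lt_trans b).
Qed.

Lemma tail_grad_restrict y x : tail_grad y x = \int[P]_w (G x \_ (upper x y)) w.
Proof. exact: Rintegral_mkcond. Qed.

Lemma tail_gradE (y x y' x' h : R) : lo <= x <= hi -> lo <= x' <= hi ->
  P.-integrable setT
     (EFin \o (fun w => h * ((G x \_ (upper x y)) w - (G x' \_ (upper x' y')) w)))
  /\ \int[P]_w (h * ((G x \_ (upper x y)) w - (G x' \_ (upper x' y')) w)) =
     h * (tail_grad y x - tail_grad y' x').
Proof.
move=> xI xI'.
have i1 := integrable_restrict P _ _ (measurable_upper x y xI) (iG x xI).
have i2 := integrable_restrict P _ _ (measurable_upper x' y' xI') (iG x' xI').
have iB : P.-integrable setT
    (EFin \o (fun w => (G x \_ (upper x y)) w - (G x' \_ (upper x' y')) w)).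
  have := integrableB measurableT i1 i2.
  by apply: eq_integrable => // w _ /=; rewrite EFinB.
split.
  have := integrableZl measurableT h iB.
  by apply: eq_integrable => // w _ /=; rewrite EFinM.
by rewrite RintegralZl // RintegralB // !tail_grad_restrict.
Qed.

Lemma in_upper x y w : (w \in upper x y) = (y <= Z x w).
Proof. by apply/idP/idP; rewrite inE. Qed.

Lemma ae_increment_bracket x x' : lo <= x <= hi -> lo <= x' <= hi ->
  {ae P, forall w, Z x w + (x' - x) * G x w <= Z x' w /\
                   Z x' w <= Z x w + (x' - x) * G x' w}.
Proof.
move=> xI xI'.
apply: filterS2 (subgradient x x' xI xI') (subgradient x' x xI' xI) => w a b.
by split => //; lra.
Qed.

(** The two positive parts of the spread are bracketed separately, and opposite bounds are
    subtracted. This mixes gradients at [x] and [x']; the mismatch telescopes when the interval is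
    subdivided. *)
Lemma mean_spread_increment (y k x x' : R) : 0 <= k ->
  lo <= x -> x <= x' -> x' <= hi ->
  (x' - x) * (tail_grad y x - tail_grad (y + k) x') <=
    mean_spread y k x' - mean_spread y k x <=
  (x' - x) * (tail_grad y x' - tail_grad (y + k) x).
Proof.
move=> k0 lx xx' x'h.
have xI : lo <= x <= hi by rewrite lx (le_trans xx').
have xI' : lo <= x' <= hi by rewrite x'h andbT (le_trans lx).
have [i1 <-] := tail_gradE y x (y + k) x' (x' - x) xI xI'.
have [i2 <-] := tail_gradE y x' (y + k) x (x' - x) xI' xI.
have s1 := integrable_spread y k x k0 xI.
have s2 := integrable_spread y k x' k0 xI'.
have s3 : P.-integrable setT (EFin \o (fun w =>
    call_spread y k (Z x' w) - call_spread y k (Z x w))).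
  have := integrableB measurableT s2 s1.
  by apply: eq_integrable => // w _ /=; rewrite EFinB.
rewrite /mean_spread -RintegralB //; apply/andP; split;
  apply: ae_le_Rintegral => //;
  apply: filterS (ae_increment_bracket x x' xI xI') => w [a b];
  have := positive_part_increment y _ _ _ _ a b;
  have := positive_part_increment (y + k) _ _ _ _ a b;
  rewrite !restrictE !in_upper /call_spread => /andP[h1 h2] /andP[h3 h4];
  move: h1 h2 h3 h4; do ![case: ifP => _ /=]; lra.
Qed.

(** Monotonicity of the derivative of a convex function: the lower bracket of the increment of
    [(Z - y)^+] is at most the upper one, and [x' - x > 0] is divided out. *)
Lemma tail_grad_homo y x x' : lo <= x -> x <= x' -> x' <= hi ->
  tail_grad y x <= tail_grad y x'.
Proof.
move=> lx; rewrite le_eqVlt => /predU1P[<- //|xx' x'h].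
have xI : lo <= x <= hi by rewrite lx (le_trans (ltW xx')).
have xI' : lo <= x' <= hi by rewrite x'h andbT (le_trans lx (ltW xx')).
rewrite -subr_ge0 -(pmulr_rge0 _ (_ : 0 < x' - x)) ?subr_gt0 //.
have [i1 <-] := tail_gradE y x' y x (x' - x) xI' xI.
rewrite -[leLHS](_ : \int[P]_w (cst 0 w) = _); last first.
  by rewrite Rintegral_cst // mul0r.
apply: ae_le_Rintegral => //; first exact: finite_measure_integrable_cst.
apply: filterS (ae_increment_bracket x x' xI xI') => w [a b].
have := positive_part_increment y _ _ _ _ a b.
rewrite !restrictE !in_upper => /andP[h1 h2].
by move: h1 h2; do ![case: ifP => _ /=]; lra.
Qed.

(** The way back from the spread, whose variation in [x] is controlled, to the tail. *)
Lemma mean_spread_tail (y k x : R) : 0 <= k -> lo <= x <= hi ->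
  k * tail x (y + k) <= mean_spread y k x <= k * tail x y.
Proof.
move=> k0 xI.
rewrite /tail -!(Rintegral_cst_restrict P) /mean_spread; try exact: measurable_upper.
apply/andP; split; apply: ae_le_Rintegral;
  try exact: integrable_spread;
  try (by apply: integrable_cst_restrict; exact: measurable_upper);
  apply: aeW => w; rewrite restrictE in_upper /=.
- by case: ifPn => [|_];
    [rewrite /call_spread|by have /andP[] := call_spread_bound y k (Z x w) k0];
   case: (leP (Z x w - y) 0); case: (leP (Z x w - (y+k)) 0); lra.
- case: ifPn => [_|]; first by have /andP[] := call_spread_bound y k (Z x w) k0.
  rewrite -ltNge /call_spread.
  by case: (leP (Z x w - y) 0); case: (leP (Z x w - (y+k)) 0); lra.
Qed.

Lemma tail_homo x y y' : lo <= x <= hi -> y <= y' -> tail x y' <= tail x y.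
Proof.
move=> xI yy'; rewrite /tail fine_le ?fin_num_measure //; try exact: measurable_upper.
apply: le_measure; rewrite ?inE; try exact: measurable_upper.
by move=> w; rewrite /upper /=; exact: le_trans.
Qed.

Definition slab x y k := [set w | y <= Z x w < y + k].

Lemma slab_preimage (x y k : R) : slab x y k = Z x @^-1` `[y, y + k[.
Proof. by apply/seteqP; split => w; rewrite /slab /= in_itv. Qed.

Lemma measurable_slab (x y k : R) : lo <= x <= hi -> measurable (slab x y k).
Proof.
by move=> /mZ mx; rewrite slab_preimage -[X in measurable X]setTI; exact: mx.
Qed.

Lemma upper_slab (x y k : R) : 0 <= k -> upper x y = slab x y k `|` upper x (y + k).
Proof.
move=> k0; apply/seteqP; split => w; rewrite /upper /slab /=.
  by move=> ->; case: (ltP (Z x w) (y + k)); [left|right].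
by case=> [/andP[]//|]; apply: le_trans; rewrite lerDl.
Qed.

Lemma slab_upper_disj (x y k : R) : [disjoint slab x y k & upper x (y + k)].
Proof.
by apply/disj_setPS => w [] /= /andP[_ a] b; move: (lt_le_trans a b); rewrite ltxx.
Qed.

Lemma tail_slab (x y k : R) : 0 <= k -> lo <= x <= hi ->
  tail x y - tail x (y + k) = fine (P (slab x y k)).
Proof.
move=> k0 xI; rewrite /tail (upper_slab x y k k0) measureU.
- by rewrite fineD ?fin_num_measure ?addrK //;
    [exact: measurable_slab|exact: measurable_upper].
- exact: measurable_slab.
- exact: measurable_upper.
- exact/disj_set2P/slab_upper_disj.
Qed.

Lemma tail_grad_slab (x y k : R) : 0 <= k -> lo <= x <= hi ->
  tail_grad y x - tail_grad (y + k) x = \int[P]_(w in slab x y k) G x w.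
Proof.
move=> k0 xI; rewrite /tail_grad (upper_slab x y k k0) Rintegral_setU.
- by rewrite addrK.
- exact: measurable_slab.
- exact: measurable_upper.
- rewrite -upper_slab //; apply: integrableS (iG x xI) => //; exact: measurable_upper.
- exact: slab_upper_disj.
Qed.

(* The mixed difference of [mean_spread] over [a, b] x [y, y + k] is close to
   c (b - a) k and to k (tail b y - tail a y); then k tends to 0. *)
Lemma tail_increment (a b c e L y r : R) :
  lo <= a -> a <= b -> b <= hi -> 0 < r ->
  (forall x k, a <= x <= b -> 0 < k < r ->
     `|tail_grad y x - tail_grad (y + k) x - c * k| <= e * k) ->
  (forall x k, a <= x <= b -> 0 < k < r -> tail x y - tail x (y + k) <= L * k) ->
  `|tail b y - tail a y - c * (b - a)| <= e * (b - a).
Proof.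
move=> la ab bh r0 Hg Ht.
have aI : lo <= a <= hi by rewrite la (le_trans ab).
have bI : lo <= b <= hi by rewrite bh (le_trans la).
have aa : a <= a <= b by rewrite lexx.
have bb : a <= b <= b by rewrite ab lexx.
(* The increment of [mean_spread] is compared with [k] times that of the tail, at a cost of at most
   [k (L k)]; then [k] is divided out. *)
have key k : 0 < k < r ->
    (b - a) * (c - e) - L * k <= tail b y - tail a y <= (b - a) * (c + e) + L * k.
  move=> /andP[k0 kr]; have kkr : 0 < k < r by rewrite k0.
  have k0' := ltW k0.
  have lower : (b - a) * (c * k - e * k) <=
      mean_spread y k b - mean_spread y k a.
    apply: (telescoped_increment_ge _ (tail_grad (y + k))) => // u v au uv vb.
    have ubI : a <= u <= b by rewrite au (le_trans uv).
    have /andP[+ _] := mean_spread_increment y k u v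
      k0' (le_trans la au) uv (le_trans vb bh).
    apply: le_trans; rewrite ler_wpM2l ?subr_ge0 //.
    by have := Hg u k ubI kkr; rewrite ler_distl; lra.
  (* The upper bound is the same telescoping applied to [- mean_spread]. *)
  have upper : (b - a) * (- (c * k + e * k)) <=
      - mean_spread y k b - - mean_spread y k a.
    apply: (telescoped_increment_ge (fun x => - mean_spread y k x)
      (tail_grad (y + k))) => // u v au uv vb.
    have vbI : a <= v <= b by rewrite vb (le_trans au).
    have /andP[_] := mean_spread_increment y k u v
      k0' (le_trans la au) uv (le_trans vb bh).
    have : (v - u) * (tail_grad y v - tail_grad (y + k) u) <=
        (v - u) * (c * k + e * k + (tail_grad (y + k) v - tail_grad (y + k) u)).
      rewrite ler_wpM2l ?subr_ge0 //.
      by have := Hg v k vbI kkr; rewrite ler_distl; lra.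
    lra.
  have /andP[ta1 ta2] := mean_spread_tail y k a k0' aI.
  have /andP[tb1 tb2] := mean_spread_tail y k b k0' bI.
  have la' := Ht a k aa kkr.
  have lb' := Ht b k bb kkr.
  have {}la' : k * (tail a y - tail a (y + k)) <= k * (L * k) by rewrite ler_pM2l.
  have {}lb' : k * (tail b y - tail b (y + k)) <= k * (L * k) by rewrite ler_pM2l.
  by apply/andP; split; rewrite -(ler_pM2l k0); lra.
have lim : forall d, 0 < d ->
    (b - a) * (c - e) - d <= tail b y - tail a y <= (b - a) * (c + e) + d.
  move=> d d0.
  (* [r / 2] keeps [k] strictly below [r]; adding 1 to [|L|] avoids a zero denominator. *)
  pose k := Num.min (r / 2) (d / (`|L| + 1)).
  have L0 : 0 < `|L| + 1 by rewrite ltr_wpDl.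
  have k0 : 0 < k by rewrite lt_min !divr_gt0.
  have kr : 0 < k < r.
    rewrite k0 /=; apply: le_lt_trans (_ : k <= r / 2) _; last by lra.
    by rewrite ge_min lexx.
  have Lk : L * k <= d.
    have : (`|L| + 1) * k <= d.
      by rewrite mulrC -ler_pdivlMr // ge_min lexx orbT.
    apply: le_trans; rewrite ler_pM2r //.
    by rewrite (le_trans (ler_norm L)) // lerDl.
  by have /andP[] := key k kr; lra.
rewrite ler_distl; apply/andP; split; apply/ler_addgt0Pr => d d0;
  by have /andP[] := lim d d0; lra.
Qed.

Lemma slab_density_estimate (x y k f0 e : R) (D : set R) (f : R -> R) :
  measurable D ->
  lo <= x <= hi -> 0 <= k -> has_density_on P (Z x) D f -> `[y, y + k[ `<=` D ->
  (forall v, y <= v < y + k -> `|f v - f0| <= e) ->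
  `|tail x y - tail x (y + k) - f0 * k| <= e * k.
Proof.
move=> mD xI k0 [mf _ dens] yD ff.
rewrite (tail_slab) // slab_preimage dens //.
have lk : fine (lebesgue_measure (`[y, y + k[%classic : set R)) = k.
  rewrite lebesgue_measure_itv /= lte_fin ltrDl; case: ltP => [_|k0'].
    by rewrite /= addrAC subrr add0r.
  by apply/eqP; rewrite eq_le k0 k0'.
have ly : (lebesgue_measure (`[y, (y + k)%R[%classic : set R) < +oo)%E.
  by rewrite lebesgue_measure_itv /=; case: ifP => _; rewrite ?ltry // -EFinB ltry.
rewrite -[in f0 * k]lk -[in e * k]lk; apply: Rintegral_bound => //.
exact: measurable_funS mf.
Qed.

(** The slab is an event of [Z x], so [G x] may be replaced there by [m (Z x)], which stays within
    [e] of [m0]. *)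
Lemma slab_cond_expectation_estimate (x y k m0 e : R) (m : R -> R) :
  lo <= x <= hi -> 0 <= k -> is_cond_expectation P (G x) (Z x) m ->
  (forall v, y <= v < y + k -> `|m v - m0| <= e) ->
  `|tail_grad y x - tail_grad (y + k) x - m0 * (tail x y - tail x (y + k))| <=
    e * (tail x y - tail x (y + k)).
Proof.
move=> xI k0 [_ mm im cm] bm.
rewrite (tail_slab) // (tail_grad_slab) //.
have ms := measurable_slab x y k xI.
have -> : \int[P]_(w in slab x y k) G x w = \int[P]_(w in slab x y k) m (Z x w).
  by rewrite /Rintegral slab_preimage cm.
apply: Rintegral_bound => //.
- by rewrite -ge0_fin_numE // fin_num_measure.
- by apply: measurableT_comp => //; apply: measurable_funTS; exact: mZ.
- by move=> w; exact: bm.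
Qed.

(** Monotonicity in [x] bounds [tail_grad] by its values at [lo] and [hi], which bounds the slopes
    in [mean_spread_increment]. *)
Lemma mean_spread_lipschitz (y k : R) : 0 <= k ->
  exists2 C, 0 <= C & forall x x', lo <= x <= hi -> lo <= x' <= hi ->
    `|mean_spread y k x' - mean_spread y k x| <= C * `|x' - x|.
Proof.
move=> k0.
pose C := `|tail_grad y hi| + `|tail_grad y lo| +
          (`|tail_grad (y + k) hi| + `|tail_grad (y + k) lo|).
exists C => [|]; first by rewrite !addr_ge0.
have b v x : lo <= x <= hi ->
    `|tail_grad v x| <= `|tail_grad v hi| + `|tail_grad v lo|.
  move=> /andP[lx xh].
  have h1 := tail_grad_homo v lo x (lexx _) lx xh.
  have h2 := tail_grad_homo v x hi lx xh (lexx _).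
  have := ler_norm (tail_grad v hi); have := ler_norm (- tail_grad v lo).
  have := normr_ge0 (tail_grad v hi); have := normr_ge0 (tail_grad v lo).
  rewrite normrN ler_norml; lra.
suff H x x' : lo <= x -> x <= x' -> x' <= hi ->
    `|mean_spread y k x' - mean_spread y k x| <= C * `|x' - x|.
  move=> x x' /andP[lx xh] /andP[lx' xh'].
  have [xx'|/ltW xx'] := leP x x'; first exact: H.
  by rewrite distrC [`|x' - x|]distrC; exact: H.
move=> lx xx' xh.
have xI : lo <= x <= hi by rewrite lx (le_trans xx').
have xI' : lo <= x' <= hi by rewrite xh andbT (le_trans lx).
have d0 : 0 <= x' - x by rewrite subr_ge0.
have /andP[h1 h2] :=
  mean_spread_increment y k x x' k0 lx xx' xh.
rewrite (ger0_norm d0) ler_norml; apply/andP; split.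
  apply: le_trans h1; rewrite -mulNr mulrC ler_wpM2l //.
  have := b y x xI; have := b (y + k) x' xI'; rewrite /C !ler_norml; lra.
apply: le_trans h2 _; rewrite mulrC ler_wpM2r //.
have := b y x' xI'; have := b (y + k) x xI; rewrite /C !ler_norml; lra.
Qed.

(** * Quantiles of the family *)

Variables (x0 : R) (q : R -> R) (alpha : R).
Hypothesis x0I : lo < x0 < hi.
Hypothesis Z0 : forall x w, 0 <= Z x w.
Hypothesis qE : forall x,
  q x = inf [set u | 0 <= u /\ (P (upper x u) <= alpha%:E)%E].

Let x0I' : lo <= x0 <= hi.
Proof. by case/andP: x0I => /ltW -> /ltW. Qed.

Lemma near_domain : \forall x \near x0, lo <= x <= hi.
Proof.
case/andP: x0I => a b; near=> x; apply/andP; split.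
  by near: x; apply: (cvgr_ge _ (@cvg_id _ (nbhs x0))).
by near: x; apply: (cvgr_le _ (@cvg_id _ (nbhs x0))).
Unshelve. all: by end_near.
Qed.

(** The spreads at [x] and [x0] differ by at most [k e], and each lies between [k] times the tails
    at [y + k] and at [y]. The shift [k] of the level allows for atoms, as no density enters
    here. *)
Lemma tail_near (y k e : R) : 0 < k -> 0 < e ->
  \forall x \near x0, tail x (y + k) <= tail x0 y + e /\
                      tail x0 (y + k) <= tail x y + e.
Proof.
move=> k0 e0.
have [C C0 HC] := mean_spread_lipschitz y k (ltW k0).
have C1 : 0 < C + 1 by rewrite ltr_wpDl.
have d0 : 0 < k * e / (C + 1) by rewrite divr_gt0 // mulr_gt0.
near=> x.
have xI : lo <= x <= hi by near: x; exact: near_domain.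
have xd : `|x - x0| <= k * e / (C + 1).
  near: x; apply: filterS (nbhsx_ballx x0 _ d0) => x.
  by rewrite /ball /= distrC => /ltW.
have h : `|mean_spread y k x - mean_spread y k x0| <= k * e.
  apply: le_trans (HC _ _ x0I' xI) _.
  move: xd; rewrite ler_pdivlMr // mulrC; apply: le_trans.
  by rewrite ler_wpM2r // lerDl.
have /andP[a1 a2] := mean_spread_tail y k x (ltW k0) xI.
have /andP[b1 b2] := mean_spread_tail y k x0 (ltW k0) x0I'.
by split; rewrite -(ler_pM2l k0) mulrDr; move: h; rewrite ler_norml; lra.
Unshelve. all: by end_near.
Qed.

Lemma tail_leE (x u : R) : lo <= x <= hi ->
  (P (upper x u) <= alpha%:E)%E = (tail x u <= alpha).
Proof.
move=> xI; rewrite -lee_fin fineK // fin_num_measure //; exact: measurable_upper.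
Qed.

Lemma quantile_le (x u : R) : lo <= x <= hi -> 0 <= u -> tail x u <= alpha ->
  q x <= u.
Proof.
move=> xI u0 ua; rewrite qE; apply: ge_inf; first by exists 0 => v [].
by split => //; rewrite tail_leE.
Qed.

(** The witness [v] makes the defining set nonempty, so that its [inf] is not the default value
    0. *)
Lemma quantile_ge (x u v : R) : lo <= x <= hi -> 0 <= v -> tail x v <= alpha ->
  alpha < tail x u -> u <= q x.
Proof.
move=> xI v0 va ua; rewrite qE; apply: lb_le_inf.
  by exists v; split => //; rewrite tail_leE.
move=> t [t0]; rewrite tail_leE // => ta; rewrite leNgt; apply/negP => tu.
have := tail_homo x t u xI (ltW tu); move: ua ta; lra.
Qed.

Lemma tail_below_quantile (x u : R) : lo <= x <= hi -> 0 <= u -> u < q x ->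
  alpha < tail x u.
Proof.
move=> xI u0; rewrite ltNge => uq; rewrite ltNge.
by apply: contra uq; exact: quantile_le.
Qed.

(** [0 < q x] rules out an empty defining set, whose [inf] would be 0. *)
Lemma tail_above_quantile (x u : R) : lo <= x <= hi -> 0 < q x -> q x < u ->
  tail x u <= alpha.
Proof.
move=> xI q0 qu.
have [A0|/set0P[v [v0]]] :=
  eqVneq [set u | 0 <= u /\ (P (upper x u) <= alpha%:E)%E] set0.
  by move: q0; rewrite qE A0 inf0 ltxx.
rewrite tail_leE // => va.
rewrite leNgt; apply/negP => /(quantile_ge x u v xI v0 va).
by rewrite leNgt qu.
Qed.

(** The Lipschitz bound forbids a jump of the tail at [q x], while the tail exceeds [alpha] just
    below and is at most [alpha] just above. *)
Lemma quantile_attained (x L r : R) : lo <= x <= hi -> 0 < q x -> 0 < r ->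
  (forall y k : R, 0 < k -> q x - r < y -> y + k < q x + r ->
     tail x y - tail x (y + k) <= L * k) ->
  tail x (q x) = alpha.
Proof.
move=> xI qx0 r0 H.
have lim d : 0 < d -> alpha - d <= tail x (q x) <= alpha + d.
  move=> d0.
  have L0 : 0 < `|L| + 1 by rewrite ltr_wpDl.
  (* [r / 2] keeps both slabs in the range of [H], and [q x / 2] keeps the level [q x - k]
     nonnegative for [tail_below_quantile]. *)
  pose k := Num.min (Num.min (r / 2) (q x / 2)) (d / (`|L| + 1)).
  have k0 : 0 < k by rewrite !lt_min !divr_gt0.
  have kr : k <= r / 2 by rewrite !ge_min lexx.
  have kq : k <= q x / 2 by rewrite !ge_min lexx orbT.
  have Lk : L * k <= d.
    have : (`|L| + 1) * k <= d.
      by rewrite mulrC -ler_pdivlMr // ge_min lexx orbT.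
    apply: le_trans; rewrite ler_pM2r //.
    by rewrite (le_trans (ler_norm L)) // lerDl.
  have a1 : tail x (q x) - tail x (q x + k) <= L * k by apply: H => //; lra.
  have a2 : tail x (q x - k) - tail x (q x - k + k) <= L * k by apply: H => //; lra.
  have b1 : tail x (q x + k) <= alpha by apply: tail_above_quantile => //; lra.
  have b2 : alpha < tail x (q x - k) by apply: tail_below_quantile => //; lra.
  by move: a2; rewrite subrK; move: a1 b1 b2; lra.
apply/eqP; rewrite eq_le; apply/andP; split; apply/ler_addgt0Pr => d d0;
  by have /andP[] := lim d d0; lra.
Qed.

(** * Local density estimates and the derivative of the quantile *)

Variables (dbar : R) (f m : R -> R -> R).
Let W (x y : R) := lo <= x <= hi /\ q x - dbar <= y <= q x + dbar.
Hypothesis dbar0 : 0 < dbar.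
Hypothesis density : forall x, lo <= x <= hi ->
  has_density_on P (Z x) `[q x - dbar, q x + dbar] (f x).
Hypothesis cond_exp : forall x, lo <= x <= hi ->
  is_cond_expectation P (G x) (Z x) (m x).
Hypothesis f_cont : forall e : R, 0 < e -> \forall p \near (x0, q x0),
  W p.1 p.2 -> `|f p.1 p.2 - f x0 (q x0)| <= e.
Hypothesis m_cont : forall e : R, 0 < e -> \forall p \near (x0, q x0),
  W p.1 p.2 -> `|m p.1 p.2 - m x0 (q x0)| <= e.
Hypothesis f_pos : 0 < f x0 (q x0).
Let f0 := f x0 (q x0).
Let m0 := m x0 (q x0).

Lemma window_slab_estimate (x e r : R) : lo <= x <= hi -> 0 < r ->
  (forall v, `|v - q x0| < r -> W x v /\ `|f x v - f0| <= e) ->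
  forall y k : R, 0 <= k -> q x0 - r < y -> y + k < q x0 + r ->
  `|tail x y - tail x (y + k) - f0 * k| <= e * k.
Proof.
move=> xI r0 H y k k0 ry ky.
have box v : y <= v < y + k -> `|v - q x0| < r.
  by move=> /andP[a b]; rewrite ltr_distl; lra.
apply: (slab_density_estimate x y k f0 e _ (f x) _ xI k0 (density x xI)).
- exact: measurable_itv.
- by move=> v /=; rewrite !in_itv /= => /box /H [[]].
- by move=> v /box /H [].
Qed.

(** At [x0] itself the window contains the radius [dbar] around [q x0], so this estimate is
    available before [q] is known to be continuous and serves to prove it. *)
Lemma tail_at_base (e : R) : 0 < e ->
  exists2 r : R, 0 < r & forall y k : R, 0 <= k -> q x0 - r < y -> y + k < q x0 + r ->
  `|tail x0 y - tail x0 (y + k) - f0 * k| <= e * k.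
Proof.
move=> e0.
have [r r0 H] := near_pair_box x0 (q x0)
  (fun x y => W x y -> `|f x y - f0| <= e)
  (f_cont e e0).
exists (Num.min r dbar); first by rewrite lt_min r0.
apply: window_slab_estimate => //; first by rewrite lt_min r0.
move=> v; rewrite lt_min => /andP[vr vd].
have Wv : W x0 v.
  by split => //; move: vd; rewrite ltr_distl => /andP[/ltW -> /ltW ->].
by split => //; apply: H => //; rewrite subrr normr0.
Qed.

(* A vanishing quantile, in particular the junk value [inf set0 = 0], would force
   the density to vanish on [- dbar, 0] because [Z] is nonnegative. *)
Lemma quantile_base_gt0 : 0 < q x0.
Proof.
have q0 : 0 <= q x0.
  rewrite qE; have [->|/set0P A0] :=
    eqVneq [set u | 0 <= u /\ (P (upper x0 u) <= alpha%:E)%E] set0.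
    by rewrite inf0.
  by apply: lb_le_inf => // u [].
rewrite lt_neqAle q0 andbT; apply/eqP => q00.
have f2 : 0 < f0 / 2 by rewrite divr_gt0.
have [r r0 H] := tail_at_base _ f2.
have full y : y <= 0 -> upper x0 y = setT.
  by move=> y0; apply/seteqP; split => w // _; rewrite /upper /= (le_trans y0).
have := H (- (r / 2)) (r / 2) (ltW (divr_gt0 r0 _)).
rewrite -q00 addNr /tail !full // ?oppr_le0 ?divr_ge0 ?(ltW r0) // subrr.
have := mulr_gt0 f_pos r0; rewrite -/f0 => fr.
move=> /(_ (ltr0Sn _ 1)) h.
have : `|0 - f0 * (r / 2)| <= f0 / 2 * (r / 2) by apply: h; lra.
rewrite sub0r normrN ger0_norm; lra.
Qed.

(** Positive density separates the tail at [x0] from [alpha] by [f0 e / 4] at the levels [q x0 + e]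
    and [q x0 - e]. By [tail_near], moving to [x] costs this margin and a further shift [e], which
    traps [q x] within [2 e] of [q x0]. *)
Lemma quantile_continuous : q x @[x --> x0] --> q x0.
Proof.
have q0 := quantile_base_gt0.
have f2 : 0 < f0 / 2 by rewrite divr_gt0.
have [r r0 H] := tail_at_base _ f2.
apply/cvgrPdist_le => e' e0'.
(* [e' / 2] accounts for the two shifts, [r / 2] keeps the slabs in the range of [H], and [q x0 / 4]
   keeps the levels nonnegative. *)
pose e := Num.min (e' / 2) (Num.min (r / 2) (q x0 / 4)).
have e0 : 0 < e by rewrite !lt_min !divr_gt0.
have ee' : e <= e' / 2 by rewrite ge_min lexx.
have er : e <= r / 2 by rewrite !ge_min lexx orbT.
have eq0 : e <= q x0 / 4 by rewrite !ge_min lexx !orbT.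
have fe : 0 < f0 * e by rewrite mulr_gt0.
have fe4 : 0 < f0 * e / 4 by rewrite divr_gt0.
(* At [q x0 + e / 2] the tail is already at most [alpha]; the remaining half step carries mass at
   least [f0 e / 4]. *)
have up : tail x0 (q x0 + e) <= alpha - f0 * e / 4.
  have := H (q x0 + e / 2) (e / 2); rewrite ler_distl -addrA -splitr => h.
  have /andP[h1 _] := h ltac:(lra) ltac:(lra) ltac:(lra).
  have : tail x0 (q x0 + e / 2) <= alpha by apply: tail_above_quantile => //; lra.
  lra.
have dn : alpha + f0 * e / 4 < tail x0 (q x0 - e).
  have := H (q x0 - e) (e / 2); rewrite ler_distl => h.
  have /andP[h1 _] := h ltac:(lra) ltac:(lra) ltac:(lra).
  have : alpha < tail x0 (q x0 - e + e / 2) by apply: tail_below_quantile => //; lra.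
  lra.
near=> x.
have xI : lo <= x <= hi by near: x; exact: near_domain.
have [h1 _] : tail x (q x0 + e + e) <= tail x0 (q x0 + e) + f0 * e / 4 /\
    tail x0 (q x0 + e + e) <= tail x (q x0 + e) + f0 * e / 4.
  by near: x; exact: tail_near.
have [_ h2] : tail x (q x0 - e - e + e) <= tail x0 (q x0 - e - e) + f0 * e / 4 /\
    tail x0 (q x0 - e - e + e) <= tail x (q x0 - e - e) + f0 * e / 4.
  by near: x; exact: tail_near.
move: h2; rewrite subrK => h2.
have t1 : tail x (q x0 + e + e) <= alpha by lra.
have t2 : alpha < tail x (q x0 - e - e) by lra.
have e1 : 0 <= q x0 + e + e by lra.
have u1 := quantile_le x _ xI e1 t1.
have u2 := quantile_ge x _ _ xI e1 t1 t2.
by rewrite ler_distl; lra.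
Unshelve. all: by end_near.
Qed.

(** Continuity of [q] places a whole rectangle around [(x0, q x0)] inside the window: [dbar / 2] is
    spent on the variation of [q] and [dbar / 2] on that of [y]. *)
Lemma joint_window_estimate (e : R) : 0 < e ->
  exists2 r : R, 0 < r & forall x y, `|x - x0| < r -> `|y - q x0| < r ->
    [/\ W x y, `|f x y - f0| <= e & `|m x y - m0| <= e].
Proof.
move=> e0.
have [r1 r10 H1] := near_pair_box x0 (q x0)
  (fun x y => W x y -> `|f x y - f0| <= e)
  (f_cont e e0).
have [r2 r20 H2] := near_pair_box x0 (q x0)
  (fun x y => W x y -> `|m x y - m0| <= e)
  (m_cont e e0).
have d2 : 0 < dbar / 2 by rewrite divr_gt0.
have [r3 /= r30 H3] : exists2 r : R, 0 < r &
    forall x, `|x - x0| < r -> lo <= x <= hi /\ `|q x - q x0| <= dbar / 2.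
  have : \forall x \near x0, lo <= x <= hi /\ `|q x - q x0| <= dbar / 2.
    near=> x; split; first by near: x; exact: near_domain.
    rewrite distrC; near: x.
    by move/cvgrPdist_le : quantile_continuous; exact.
  move=> /nbhs_ballP[r /= r0 h]; exists r => // x xr.
  by apply: h; rewrite /ball /= distrC.
pose r := Num.min (Num.min r1 r2) (Num.min r3 (dbar / 2)).
exists r; first by rewrite !lt_min r10 r20 r30.
move=> x y; rewrite !lt_min => /andP[/andP[x1 x2] /andP[x3 _]].
move=> /andP[/andP[y1 y2] /andP[_ y4]].
have [xI] := H3 x x3; rewrite ler_distl => qx.
have Wxy : W x y.
  by split => //; move: y4 qx; rewrite ltr_distl; lra.
by split => //; [exact: H1|exact: H2].
Unshelve. all: by end_near.
Qed.

(** [implicit_derivative] is applied to [tail], with slope [m0 f0] in [x] and [- f0] in [y]. The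
    former comes from [tail_increment], since a thin slab near [q x0] has mass about [f0 k] and mean
    gradient about [m0]. *)
Lemma quantile_derivative : is_derive x0 1 q (m x0 (q x0)).
Proof.
have -> : m x0 (q x0) = m0 * f0 / f0 by rewrite mulfK // gt_eqF.
apply: (implicit_derivative tail) => //.
- exact: quantile_continuous.
- move=> e e0.
  (* With [e1 <= 1] a slab has mass at most [(f0 + 1) k]; the errors [e1 (f0 + 1) k] from [m] and
     [|m0| e1 k] from [f] add up to [e1 C k]. *)
  pose C := 1 + f0 + `|m0|.
  have C0 : 0 < C by rewrite /C ltr_wpDr // ltr_wpDr // ltW.
  pose e1 := Num.min 1 (e / C).
  have e10 : 0 < e1 by rewrite lt_min ltr01 divr_gt0.
  have e1e : e1 * C <= e by rewrite -ler_pdivlMr // ge_min lexx orbT.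
  have e11 : e1 <= 1 by rewrite ge_min lexx.
  have [r r0 H] := joint_window_estimate e1 e10.
  (* Halving [r] for both [y] and [k] keeps all of [[y, y + k[] within [r] of [q x0]. *)
  have slabs x y k : `|x - x0| < r -> `|y - q x0| < r / 2 -> 0 < k < r / 2 ->
      `|tail_grad y x - tail_grad (y + k) x - m0 * f0 * k| <= e * k /\
      tail x y - tail x (y + k) <= (f0 + 1) * k.
    move=> xr yr /andP[k0 kr].
    have xI : lo <= x <= hi.
      by have [] := H x (q x0) xr; rewrite ?subrr ?normr0 // => -[].
    have box v : y <= v < y + k -> `|v - q x0| < r.
      by move: yr; rewrite !ltr_distl; lra.
    have hf : `|tail x y - tail x (y + k) - f0 * k| <= e1 * k.
      apply: (window_slab_estimate x e1 r) => //.
      + by move=> v vr; have [] := H x v xr vr.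
      + exact: ltW.
      + by move: yr; rewrite ltr_distl; lra.
      + by move: yr; rewrite ltr_distl; lra.
    have hm := slab_cond_expectation_estimate x y k m0 e1 (m x)
      xI (ltW k0) (cond_exp x xI).
    have {}hm := hm (fun v vb => let: And3 _ _ h := H x v xr (box v vb) in h).
    have e1k : e1 * k <= k by rewrite ler_piMl // ltW.
    have p : tail x y - tail x (y + k) <= (f0 + 1) * k.
      by move: hf; rewrite ler_distl; lra.
    split => //.
    set p' := tail x y - _ in hm hf p.
    have -> : tail_grad y x - tail_grad (y + k) x - m0 * f0 * k =
      (tail_grad y x - tail_grad (y + k) x - m0 * p') + m0 * (p' - f0 * k) by ring.
    apply: le_trans (ler_normD _ _) _; rewrite normrM.
    have : `|m0| * `|p' - f0 * k| <= `|m0| * (e1 * k) by rewrite ler_wpM2l.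
    have : e1 * p' <= e1 * ((f0 + 1) * k) by rewrite ler_wpM2l // ltW.
    have : e1 * C * k <= e * k by rewrite ler_wpM2r // ltW.
    by rewrite /C; move: hm; lra.
  exists (ball x0 r, ball (q x0) (r / 2)).
    by split; apply: nbhsx_ballx; rewrite ?divr_gt0.
  move=> [x y] [/= xr yr]; rewrite /ball /= distrC in xr.
  rewrite /ball /= distrC in yr.
  have xI : lo <= x <= hi.
    by have [] := H x (q x0) xr; rewrite ?subrr ?normr0 // => -[].
  have r2 : 0 < r / 2 by rewrite divr_gt0.
  have [xx|/ltW xx] := leP x0 x.
    rewrite [X in _ <= _ * X]ger0_norm ?subr_ge0 //.
    apply: (tail_increment _ _ _ _ (f0 + 1) _ (r / 2)) => //;
      try (by case/andP: x0I'); try (by case/andP: xI);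
      move=> v k vI kI; have vr : `|v - x0| < r by move: xr; rewrite !ltr_distl; lra.
      by have [] := slabs v y k vr yr kI.
    by have [] := slabs v y k vr yr kI.
  (* For [x] below [x0] the increment is taken over [[x, x0]] and the sign reversed. *)
  rewrite [X in _ <= _ * X]distrC [X in _ <= _ * X]ger0_norm ?subr_ge0 //.
  rewrite -normrN.
  rewrite [X in `|X|](_ : _ = tail x0 y - tail x y - m0 * f0 * (x0 - x));
      last by ring.
  apply: (tail_increment _ _ _ _ (f0 + 1) _ (r / 2)) => //;
      try (by case/andP: x0I'); try (by case/andP: xI);
      move=> v k vI kI; have vr : `|v - x0| < r by move: xr; rewrite !ltr_distl; lra.
    by have [] := slabs v y k vr yr kI.
  by have [] := slabs v y k vr yr kI.
- move=> e e0; have [r r0 H] := tail_at_base e e0.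
  apply/nbhs_ballP; exists r => //= y; rewrite /ball /= distrC ltr_distl => yr.
  have [qy|/ltW yq] := leP (q x0) y.
    rewrite [X in _ <= _ * X]ger0_norm ?subr_ge0 //.
    have := H (q x0) (y - q x0).
    rewrite subr_ge0 (_ : q x0 + (y - q x0) = y) => [h|];
      last by ring.
    rewrite -normrN.
    rewrite [X in `|X|](_ : _ = tail x0 (q x0) - tail x0 y - f0 * (y - q x0));
      last by ring.
    by apply: h => //; lra.
  have := H y (q x0 - y).
  rewrite subr_ge0 (_ : y + (q x0 - y) = q x0) => [h|];
      last by ring.
  rewrite [X in _ <= _ * X]distrC [X in _ <= _ * X]ger0_norm ?subr_ge0 //.
  rewrite [X in `|X|](_ : _ = tail x0 y - tail x0 (q x0) - f0 * (q x0 - y));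
      last by ring.
  by apply: h => //; lra.
(* The tail at the quantile stays equal to [alpha]: the estimate with error 1 gives the Lipschitz
   constant [f0 + 1] that [quantile_attained] asks for. *)
- have [r r0 H] := joint_window_estimate 1 ltr01.
  have att x : lo <= x <= hi -> 0 < q x -> `|x - x0| < r -> `|q x - q x0| < r / 2 ->
      tail x (q x) = alpha.
    move=> xI qx0 xr qr; apply: (quantile_attained x (f0 + 1) (r / 2)) => //.
      by rewrite divr_gt0.
    move=> y k k0 ya yb.
    have := window_slab_estimate x 1 r xI r0
      (fun v vr => let: And3 a b _ := H x v xr vr in conj a b) y k (ltW k0).
    rewrite ler_distl => h.
    have y1 : q x0 - r < y by move: qr; rewrite ltr_distl; lra.
    have y2 : y + k < q x0 + r by move: qr; rewrite ltr_distl; lra.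
    by have := h y1 y2; lra.
  have q0 := quantile_base_gt0.
  rewrite (att x0) ?subrr ?normr0 ?divr_gt0 //.
  (* The minimum with [q x0] ensures [0 < q x]. *)
  have d0 : 0 < Num.min (r / 2) (q x0) by rewrite lt_min divr_gt0.
  near=> x.
  have : `|q x0 - q x| < Num.min (r / 2) (q x0).
    by near: x; move/cvgrPdist_lt : quantile_continuous; exact.
  rewrite lt_min => /andP[qa qb].
  apply: att.
  + by near: x; exact: near_domain.
  + by move: qb; rewrite ltr_distl; lra.
  + rewrite distrC; near: x; exact: (nbhsx_ballx x0 r).
  + by rewrite distrC.
Unshelve. all: by end_near.
Qed.

End convex_family.

(** * Running suprema of càdlàg paths *)

Section paths.
Context {R : realType}.
Implicit Types (x : R -> R) (T t : R).

Lemma cvg_near_leD {T' : Type} (F : set_system T') {FF : Filter F}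
    (u : T' -> R) (l e : R) :
  u @ F --> l -> 0 < e -> \forall s \near F, u s <= l + e.
Proof. by move=> ul e0; apply: (cvgr_le _ ul); rewrite ltrDl. Qed.

Lemma near_right_left x t (Q : R -> Prop) :
  Q t -> (\forall s \near t^'+, Q s) -> (\forall s \near t^'-, Q s) ->
  \forall s \near t, Q s.
Proof.
move=> Qt; rewrite !near_withinE => Qr Ql.
apply: filterS2 Qr Ql => s sr sl.
by have [/sl|/sr|->] := ltgtP s t.
Qed.

Definition right_continuous x :=
  forall t, 0 <= t -> x s @[s --> t^'+] --> x t.

(** Right continuity and the left limit give an upper bound near each time; compactness of [[0, T]]
    makes it uniform. *)
Lemma cadlag_bounded_above x T : cadlag x ->
  has_ubound [set x t | t in `[0, T]].
Proof.
move=> [xr xl].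
have : \forall M \near +oo, `[0, T] `<=` (fun t => x t <= M).
  have /compact_near_coveringP/near_covering_withinP := @segment_compact R 0 T.
  apply => t; rewrite /= in_itv /= => /andP[t0 tT].
  have [C HC] : exists C, \forall s \near t, s \in `[0, T] -> x s <= C.
    have : exists C, \forall s \near t^'-, s \in `[0, T] -> x s <= C.
      (* At time 0 the left neighbourhood lies outside [[0, T]], so any bound serves. *)
      move: t0; rewrite le_eqVlt => /predU1P[<-|t0].
        exists 0; rewrite near_withinE; apply: nearW => s s0.
        by rewrite in_itv /= leNgt s0.
      have /cvg_ex[l xtl] := xl t t0; exists (l + 1).
      by apply: filterS (cvg_near_leD _ _ _ _ xtl ltr01).
    move=> [C HC]; exists (Num.max C (x t + 1)).
    apply: near_right_left => //.
    - by move=> _; rewrite le_max lerDl ler01 orbT.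
    - apply: filterS (cvg_near_leD _ _ _ _ (xr t t0) ltr01) => s xs _.
      by rewrite le_max xs orbT.
    - by apply: filterS HC => s h /h {}h; rewrite le_max h.
  exists ([set s | s \in `[0, T] -> x s <= C], [set M | C <= M]).
    by split => //; exact: nbhs_pinfty_ge (num_real C).
  by move=> [s M] [/= h CM] /h /le_trans; exact.
move=> /(@filter_ex _ _ _)[M HM]; exists M => _ [t tT <-].
exact: HM.
Qed.

Definition upper_semicontinuous_on T x :=
  forall t, 0 <= t <= T -> forall e, 0 < e ->
  \forall s \near t, s \in `[0, T] -> x s <= x t + e.

(** If the supremum were not attained, the path would stay below it near each time by half the gap
    at that time; by compactness one positive margin would work on all of [[0, T]], which is
    absurd. *)
Lemma usc_attained x T : 0 <= T -> has_ubound [set x t | t in `[0, T]] ->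
  upper_semicontinuous_on T x ->
  exists2 t, t \in `[0, T] & x t = sup [set x t | t in `[0, T]].
Proof.
move=> T0 ub usc; apply: contrapT => no.
set A := [set x t | t in `[0, T]] in ub no.
have A0 : A !=set0 by exists (x 0), 0 => //=; rewrite in_itv /= lexx.
have lt_sup t : t \in `[0, T] -> x t < sup A.
  move=> tT; rewrite lt_neqAle; apply/andP; split.
    by apply/eqP => xt; apply: no; exists t.
  by apply: ub_le_sup => //; exists t.
have : \forall e \near 0^'+, `[0, T] `<=` (fun t => x t <= sup A - e).
  have /compact_near_coveringP/near_covering_withinP := @segment_compact R 0 T.
  apply => t; rewrite /= => tT.
  have d0 : 0 < (sup A - x t) / 2 by rewrite divr_gt0 // subr_gt0 lt_sup.
  exists ([set s | s \in `[0, T] -> x s <= x t + (sup A - x t) / 2],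
          [set e | e <= (sup A - x t) / 2]).
    split => /=; last exact: nbhs_right_le.
    by apply: usc => //; move: tT; rewrite in_itv.
  by move=> [s e] [/= h eM] /h; lra.
move=> H.
have [e [e0 He]] : exists e, 0 < e /\ `[0, T] `<=` (fun t => x t <= sup A - e).
  near (0 : R)^'+ => e; exists e; split => //.
  by near: e.
suff : sup A <= sup A - e by lra.
by apply: ge_sup => // _ [t tT <-]; exact: He.
Unshelve. all: by end_near.
Qed.

(** Points of the level set come arbitrarily close to its infimum from the right, so right
    continuity carries the value [M] there. Thus the first maximising time is itself a maximiser. *)
Lemma right_continuous_inf_level x T M (A := [set t | t \in `[0, T] /\ x t = M]) :
  right_continuous x -> A !=set0 -> A (inf A).
Proof.
move=> xr [a0 Aa0].
have lbA : has_lbound A by exists 0 => t [] /[!in_itv] /= /andP[].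
have hi : has_inf A by split => //; exists a0.
have i0 : 0 <= inf A.
  by apply: lb_le_inf; [exists a0|move=> t [] /[!in_itv] /= /andP[]].
have iT : inf A <= T.
  by apply: le_trans (ge_inf lbA Aa0) _; move: Aa0 => [] /[!in_itv] /= /andP[].
split; first by rewrite in_itv /= i0.
apply/eqP; rewrite -subr_eq0 -normr_le0; apply/ler_addgt0Pr => e e0.
rewrite add0r.
have : \forall s \near (inf A)^'+, `|x (inf A) - x s| <= e.
  by move/cvgrPdist_le : (xr _ i0); exact.
rewrite near_withinE => /nbhs_ballP[r /= r0 H].
have [a Aa ar] := inf_adherent r0 hi.
have := ge_inf lbA Aa; rewrite le_eqVlt => /predU1P[->|ia].
  by case: Aa => _ ->; rewrite subrr normr0 ltW.
have [_ <-] := Aa; apply: H => //.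
by rewrite /ball /= distrC ltr_distl; lra.
Qed.

Lemma cadlag_right_continuous x : cadlag x -> right_continuous x.
Proof. by case. Qed.

Lemma cadlag0 : cadlag (0 : R -> R).
Proof. by split => t _; [exact: cvg_cst|exact: is_cvg_cst]. Qed.

Lemma cadlagD x x' : cadlag x -> cadlag x' -> cadlag (x + x').
Proof.
move=> [xr xl] [xr' xl']; split => t t0; first exact: cvgD (xr _ _) (xr' _ _).
exact: is_cvgD (xl _ _) (xl' _ _).
Qed.

Lemma cadlagMl a x : cadlag x -> cadlag (fun t => a * x t).
Proof.
move=> [xr xl]; split => t t0; first exact: cvgMr (xr _ _).
exact: is_cvgMr (xl _ _).
Qed.

Lemma cadlag_sum I (r : seq I) (Q : pred I) (F : I -> R -> R) :
  (forall j, cadlag (F j)) -> cadlag (\sum_(j <- r | Q j) F j).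
Proof.
move=> cF; elim/big_ind: _ => //; [exact: cadlag0|exact: cadlagD].
Qed.

End paths.

(** * Measurability and attainment of the running supremum *)

Section running_supremum.
Context {disp : measure_display} {R : realType} {Omega : measurableType disp}.
Implicit Types (X : R -> Omega -> R) (T : R).

Lemma running_sup_ge X T t w : cadlag (X ^~ w) -> t \in `[0, T] ->
  X t w <= running_sup X T w.
Proof.
by move=> cX tT; apply: ub_le_sup; [exact: cadlag_bounded_above|exists t].
Qed.

(** By right continuity a level exceeded before [T] is exceeded at a rational time. The time [T] has
    no later times in range; clamping to [[0, T]] lets every rational above [T] stand for it. *)
Lemma measurable_running_sup X T : 0 <= T ->
  (forall w, cadlag (X ^~ w)) ->
  (forall t, 0 <= t -> measurable_fun setT (X t)) ->
  measurable_fun setT (running_sup X T).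
Proof.
move=> T0 cX mX.
pose clamp (r : rat) : R := Num.max 0 (Num.min T (ratr r)).
have clampI r : clamp r \in `[0, T].
  by rewrite in_itv /= /clamp le_max lexx /= ge_max T0 ge_min lexx.
move=> mD; apply: (measurability _ (RGenOInfty.measurableE R)) => //.
move=> _ [_ [y ->] <-]; rewrite setTI.
rewrite (_ : _ @^-1` _ = \bigcup_(r : rat) (X (clamp r) @^-1` `]y, +oo[)).
  apply: bigcupT_measurable_rat => r; rewrite -[_ @^-1` _]setTI.
  have c0 : 0 <= clamp r by have := clampI r; rewrite in_itv /= => /andP[].
  exact: mX c0 measurableT _ (measurable_itv _).
apply/seteqP; split => w; rewrite /= in_itv /= andbT; last first.
  move=> [r _ /=]; rewrite in_itv /= andbT => /lt_le_trans; apply.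
  exact: running_sup_ge.
have A0 : [set X t w | t in `[0, T]] !=set0.
  by exists (X 0 w), 0 => //=; rewrite in_itv /= lexx.
move=> /(sup_gt A0)[_ [t /= tT <-] yt].
have := tT; rewrite in_itv /= => /andP[t0].
rewrite le_eqVlt => /predU1P[tE|ltT].
  have [r Tr] := @rat_in_itvoo R T (T + 1) ltac:(lra).
  exists r => //=; rewrite in_itv /= andbT /clamp.
  move: Tr; rewrite in_itv /= => /andP[Tr _].
  by rewrite min_l ?(ltW Tr) // max_r // -tE.
have : \forall s \near t^'+, y < X s w.
  have [xr _] := cX w; exact: (cvgr_gt _ (xr t t0)).
rewrite near_withinE => /nbhs_ballP[d /= d0 H].
have tTd : t < Num.min T (t + d) by rewrite lt_min ltT ltrDl.
have [r rI] := rat_in_itvoo tTd.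
move: rI; rewrite in_itv /= lt_min => /and3P[tr rT rd].
exists r => //=; rewrite in_itv /= andbT /clamp.
rewrite min_r ?(ltW rT) // max_r; last by rewrite (le_trans t0) // ltW.
by apply: H => //; rewrite /ball /= distrC ltr_distl; lra.
Qed.

Lemma argmax_times_first X T w : right_continuous (X ^~ w) ->
  argmax_times X T w !=set0 ->
  argmax_times X T w (fine (first_argmax X T w)).
Proof.
move=> rX A0; rewrite /first_argmax ereal_inf_EFin //.
  exact: right_continuous_inf_level.
by exists 0 => t [] /[!in_itv] /= /andP[].
Qed.

Variable P : probability Omega R.

(** For compound Poisson paths, right continuity handles later times. At an earlier time [s] the
    jump sum is no larger, since jumps are positive, and the drift term exceeds that at [t] by
    [c (t - s)], which is at most [e] once [t - s < e / c]. *)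
Lemma admissible_usc X T : (forall w, cadlag (X ^~ w)) ->
  admissible_process P X ->
  {ae P, forall w, upper_semicontinuous_on T (X ^~ w)}.
Proof.
move=> cX [|].
  apply: filterS => w /subspace_continuousP cw t /andP[t0 tT] e e0.
  have tI : `[0, +oo[%classic t by rewrite /= in_itv /= t0.
  have : \forall s \near within `[0, +oo[ (nbhs t), X s w <= X t w + e.
    exact: cvg_near_leD (cw t tI) e0.
  rewrite near_withinE; apply: filterS => s h sI; apply: h.
  by move: sI; rewrite /= !in_itv /= => /andP[->].
move=> [c [lambda [N [J [[c0 _ pN] [_ Jpos _ XE]]]]]].
apply: filterS2 Jpos XE => w Jw {}XE t /andP[t0 tT] e e0.
apply: near_right_left => //.
- by move=> _; rewrite lerDl ltW.
- have [xr _] := cX w.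
  by apply: filterS (cvg_near_leD _ _ _ _ (xr t t0) e0).
- rewrite near_withinE; apply/nbhs_ballP; exists (e / c) => /=.
    by rewrite divr_gt0.
  move=> s; rewrite /ball /= => st lts sI.
  have s0 : 0 <= s by move: sI; rewrite in_itv /= => /andP[].
  rewrite !XE //.
  have : \sum_(k < N s w) J k w <= \sum_(k < N t w) J k w.
    rewrite -!(big_mkord xpredT (fun k => J k w)).
    rewrite [leRHS](big_cat_nat (leq0n _) (poisson_monotone pN w s0 (ltW lts))) /=.
    by rewrite lerDl sumr_ge0 // => k _; exact: ltW.
  have : c * (t - s) <= e.
    rewrite mulrC -ler_pdivlMr // (le_trans (ler_norm _)) //; exact: ltW.
  lra.
Qed.

End running_supremum.

(** * The perturbed aggregate as a convex family *)

Section perturbed_process.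
Context {disp : measure_display} {R : realType} {Omega : measurableType disp}.
Variables (P : probability Omega R) (n : nat) (S : 'I_n -> R -> Omega -> R).
Hypothesis hS : levy_process P S.
Variables (i : 'I_n) (T : R).
Hypothesis T0 : 0 <= T.

Lemma perturbed_cadlag x w : cadlag (perturbed S i x ^~ w).
Proof.
have -> : perturbed S i x ^~ w =
    \sum_(j < n | j != i) (S j ^~ w) + (fun t => x * S i t w).
  by apply/funext => t; rewrite /perturbed fctE fct_sumE.
apply: cadlagD; last by apply: cadlagMl; exact: (levy_cadlag hS).
by apply: cadlag_sum => j; exact: (levy_cadlag hS).
Qed.

Lemma measurable_perturbed x t : 0 <= t ->
  measurable_fun setT (perturbed S i x t).
Proof.
move=> t0; apply: measurable_funD.
  rewrite (_ : (fun _ => _) =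
    fun w => \sum_(j <- [seq j <- index_enum 'I_n | j != i]) S j t w).
    by apply: measurable_sum => j; exact: (levy_measurable hS).
  by apply/funext => w; rewrite big_filter.
by apply: measurable_funM => //; exact: (levy_measurable hS).
Qed.

Lemma perturbed_sup_ge0 x w : 0 <= running_sup (perturbed S i x) T w.
Proof.
have <- : perturbed S i x 0 w = 0.
  rewrite /perturbed (levy_start hS) mulr0 addr0 big1 // => j _.
  exact: (levy_start hS).
by apply: running_sup_ge; [exact: perturbed_cadlag|rewrite in_itv /= lexx].
Qed.

(** At the first maximising time for [x], the process for [x'] takes the value on the left, which is
    at most its own supremum. Admissibility provides such a time almost surely, so that [fine] does
    not return its default 0 for an infinite time. *)
Lemma perturbed_subgradient x x' : admissible_process P (perturbed S i x) ->
  {ae P, forall w, running_sup (perturbed S i x) T w +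
      (x' - x) * at_first_argmax S T i x w <= running_sup (perturbed S i x') T w}.
Proof.
move=> /(admissible_usc P _ T (perturbed_cadlag x)); apply: filterS => w usc.
have [t tT xt] := usc_attained _ _ T0
  (cadlag_bounded_above _ _ (perturbed_cadlag x w)) usc.
have A0 : argmax_times (perturbed S i x) T w !=set0 by exists t.
have [tI tE] := argmax_times_first _ _ _
  (cadlag_right_continuous _ (perturbed_cadlag x w)) A0.
rewrite -tE /at_first_argmax.
apply: le_trans (running_sup_ge _ _ _ _ (perturbed_cadlag x' w) tI).
by rewrite /perturbed -addrA -mulrDl [x + _]addrC subrK.
Qed.

End perturbed_process.

(** * Continuity on the window and the gradient allocation *)

Lemma jointly_continuous_near {R : realType} (q : R -> R) (delta dbar x0 : R)
    (g : R -> R -> R) (e : R) :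
  1 - delta <= x0 <= 1 + delta -> 0 <= dbar ->
  jointly_continuous_on (window q delta dbar) g -> 0 < e ->
  \forall p \near (x0, q x0),
    1 - delta <= p.1 <= 1 + delta /\ q p.1 - dbar <= p.2 <= q p.1 + dbar ->
    `|g p.1 p.2 - g x0 (q x0)| <= e.
Proof.
move=> xI d0 /subspace_continuousP gc e0.
have W0 : window q delta dbar (x0, q x0).
  by split; rewrite /= in_itv //= gerBl lerDl d0.
have : \forall p \near within (window q delta dbar) (nbhs (x0, q x0)),
    `|g x0 (q x0) - g p.1 p.2| <= e.
  by move/cvgrPdist_le : (gc _ W0); exact.
rewrite near_withinE; apply: filterS => p h [p1 p2].
by rewrite distrC; apply: h; split; rewrite in_itv.
Qed.

Theorem theorem4 (R : realType) (disp : measure_display)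
    (Omega : measurableType disp) (P : probability Omega R)
    (n : nat) (S : 'I_n -> R -> Omega -> R) (T alpha : R) (i : 'I_n)
    (delta dbar : R) (f m mabs : R -> R -> R)
    (hS : levy_process P S)
    (hT : 0 < T)
    (halpha : 0 <= alpha <= 1)
    (hdelta : 0 < delta)
    (hdbar : 0 < dbar)
    (hindiv : forall j, admissible_process P (S j))
    (haggr : forall x : R, x \in `[1 - delta, 1 + delta] ->
       admissible_process P (perturbed S i x))
    (hdensity : forall x : R, x \in `[1 - delta, 1 + delta] ->
       has_density_on P (running_sup (perturbed S i x) T)
         `[quantile P S alpha T i x - dbar, quantile P S alpha T i x + dbar]
         (f x))
    (hf_cont : jointly_continuous_on
       (window (quantile P S alpha T i) delta dbar) f)
    (hf_pos : forall x : R, x \in `[1 - delta, 1 + delta] ->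
       0 < f x (quantile P S alpha T i x))
    (hm : forall x : R, x \in `[1 - delta, 1 + delta] ->
       is_cond_expectation P (at_first_argmax S T i x)
         (running_sup (perturbed S i x) T) (m x))
    (hm_cont : jointly_continuous_on
       (window (quantile P S alpha T i) delta dbar) m)
    (hmabs : forall x : R, x \in `[1 - delta, 1 + delta] ->
       is_cond_expectation P (fun w => `|at_first_argmax S T i x w|)
         (running_sup (perturbed S i x) T) (mabs x))
    (hmabs_cont : jointly_continuous_on
       (window (quantile P S alpha T i) delta dbar) mabs)
    (hsup : (\int[P]_w (running_sup (fun t w' => `|S i t w'|) T w)%:E
             < +oo)%E) :
  derivable (quantile P S alpha T i) 1 1 /\
  GVaR P S alpha T i = m 1 (dynVaR P alpha (aggregate S) T).
Proof.
have T0 := ltW hT.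
have dom x : 1 - delta <= x <= 1 + delta -> x \in `[1 - delta, 1 + delta].
  by rewrite in_itv.
have x0I : 1 - delta < 1 < 1 + delta by rewrite ltrBlDr !ltrDl hdelta.
have x0I' : 1 - delta <= 1 <= 1 + delta by case/andP: x0I => /ltW -> /ltW ->.
(* The convex family is the running supremum over the parameters [[1 - delta, 1 + delta]], with
   subgradient [at_first_argmax] and base point 1. *)
have dq : is_derive (1 : R) 1 (quantile P S alpha T i)
    (m 1 (quantile P S alpha T i 1)).
  apply: (@quantile_derivative _ _ _ P (1 - delta) (1 + delta)
    (fun x => running_sup (perturbed S i x) T) (at_first_argmax S T i)
    _ _ _ 1 _ alpha x0I _ _ dbar f m hdbar).
  - move=> x xI; apply: measurable_running_sup => //.
      by move=> w; exact: perturbed_cadlag hS _ _ _.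
    by move=> t t0; exact: measurable_perturbed hS _ _ _ t0.
  - by move=> x /dom /hm [].
  - move=> x x' /dom /haggr xa _; exact: perturbed_subgradient hS _ _ T0 _ _ xa.
  - by move=> x w; exact: perturbed_sup_ge0 hS _ _ T0 _ _.
  - by [].
  - by move=> x /dom /hdensity.
  - by move=> x /dom /hm.
  - by move=> e; exact: jointly_continuous_near (ltW hdbar) hf_cont.
  - by move=> e; exact: jointly_continuous_near (ltW hdbar) hm_cont.
  - exact/hf_pos/dom.
split; first exact: ex_derive.
rewrite /GVaR derive1E derive_val.
by rewrite /quantile perturbed1.
Qed.
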